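(* Let $a<b$ be real numbers. For all $f\in C[a,b]$, all $\lambda,\mu\in[0,1]$ and all $x\in\left[a,\frac{a+b}{2}\right]$, $$|E(f;\lambda,\mu;x)|\le \tilde\omega\left(f,\frac{C(x,\lambda,\mu)}{2(b-a)}\right),$$ where $E$ is the generalized Alomari functional, $\tilde\omega(f,\cdot)$ is the least concave majorant of the first modulus of continuity of $f$, and $C(x,\lambda,\mu)$ is the explicit constant, all as defined in the context.
   Context: For $f\in C[a,b]$, $\lambda,\mu\in[0,1]$, $x\in[a,b]$, $$E(f;\lambda,\mu;x):=\frac{1}{b-a}\int_a^b f(t)\,dt-\left\{\lambda\frac{f(a)+f(b)}{2}+(1-\lambda)\left[\mu f(x)+(1-\mu)f(a+b-x)\right]\right\}.$$ The first modulus of continuity is $\omega(f,h):=\sup\{|f(u)-f(v)|: u,v\in[a,b],\ |u-v|\le h\}$ for $h\in[0,b-a]$, and $\tilde\omega(f,\cdot)$ is the least concave majorant on $[0,b-a]$ of the map $t\mapsto\omega(f,t)$, i.e. the pointwise infimum of all concave functions $g\ge\omega(f,\cdot)$ on $[0,b-a]$. Put $\nu_2:=\nu_2(\lambda,\mu):=a+(b-a)\left(\frac{\lambda}{2}+\mu(1-\lambda)\right)$. For $x\in\left[a,a+\lambda\frac{b-a}{2}\right]$, $$C(x,\lambda,\mu):=2\lambda(x-a)(b-a)-2(x-a)^2+(x-\nu_2)^2+(a+b-x-\nu_2)^2,$$ and for $x\in\left[a+\lambda\frac{b-a}{2},\frac{a+b}{2}\right]$, $$C(x,\lambda,\mu):=(x-a)^2+\left[\lambda(b-a)-(x-a)\right]^2+\tilde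 C(x,\lambda,\mu),$$ with $$\tilde C(x,\lambda,\mu):=\begin{cases}(x-\nu_2)^2+(a+b-x-\nu_2)^2, & \mu\in[0,\tfrac12],\ x\le\nu_2,\\ -(x-\nu_2)^2+(a+b-x-\nu_2)^2, & \mu\in[0,\tfrac12],\ x>\nu_2,\\ (x-\nu_2)^2+(a+b-x-\nu_2)^2, & \mu\in(\tfrac12,1],\ x\le a+b-\nu_2,\\ (x-\nu_2)^2-(a+b-x-\nu_2)^2, & \mu\in(\tfrac12,1],\ x>a+b-\nu_2.\end{cases}$$ (The two formulas for $C$ agree at $x=a+\lambda\frac{b-a}{2}$.) *)

(* Defs.v *)
From Stdlib Require Import Reals Lra.
From Coquelicot Require Import Coquelicot.
Open Scope R_scope.

(** A function in [C[a,b]] is represented by a total function [f : R -> R]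
    satisfying [continuous_on (segment a b) f], that is, continuity relative to
    [a,b].  None of the definitions below depends on the values of [f] outside
    [a,b] when [a < b] and [a <= x <= b]. *)
Definition segment (a b : R) : R -> Prop := fun t => a <= t <= b.

Definition alomari (a b : R) (f : R -> R) (lambda mu x : R) : R :=
  / (b - a) * RInt f a b
  - (lambda * ((f a + f b) / 2)
     + (1 - lambda) * (mu * f x + (1 - mu) * f (a + b - x))).

(** The projection [real : Rbar -> R] sends infinite values to 0.  For [f]
    continuous on [a,b], [a <= b] and [0 <= h], the set below is nonempty and
    bounded, so this is its genuine supremum. *)
Definition modulus (a b : R) (f : R -> R) (h : R) : R :=
  real (Lub_Rbar (fun y => exists u v : R,
    segment a b u /\ segment a b v /\ Rabs (u - v) <= h /\
    y = Rabs (f u - f v))).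

Definition concave_on (a b : R) (g : R -> R) : Prop :=
  forall s t theta : R,
    segment a b s -> segment a b t -> 0 <= theta <= 1 ->
    theta * g s + (1 - theta) * g t <= g (theta * s + (1 - theta) * t).

(** Pointwise infimum, at [t], of the functions concave on [0,b-a] that
    dominate [modulus a b f] there.  For [f] continuous on [a,b] and [t] in
    [0,b-a] it is finite: a constant is an admissible [g], and all the values
    are nonnegative. *)
Definition concave_majorant (a b : R) (f : R -> R) (t : R) : R :=
  real (Glb_Rbar (fun y => exists g : R -> R,
    concave_on 0 (b - a) g /\
    (forall h : R, segment 0 (b - a) h -> modulus a b f h <= g h) /\
    y = g t)).

Definition nu2 (a b lambda mu : R) : R :=
  a + (b - a) * (lambda / 2 + mu * (1 - lambda)).

Definition Ctilde (a b x lambda mu : R) : R :=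
  let nu := nu2 a b lambda mu in
  if Rle_dec mu (1 / 2) then
    if Rle_dec x nu
    then (x - nu) ^ 2 + (a + b - x - nu) ^ 2
    else - (x - nu) ^ 2 + (a + b - x - nu) ^ 2
  else
    if Rle_dec x (a + b - nu)
    then (x - nu) ^ 2 + (a + b - x - nu) ^ 2
    else (x - nu) ^ 2 - (a + b - x - nu) ^ 2.

(** Meaningful for [a <= x <= (a + b) / 2]; the two formulas agree at the
    breakpoint [x = a + lambda * ((b - a) / 2)]. *)
Definition Cconst (a b x lambda mu : R) : R :=
  let nu := nu2 a b lambda mu in
  if Rle_dec x (a + lambda * ((b - a) / 2))
  then 2 * lambda * (x - a) * (b - a) - 2 * (x - a) ^ 2
       + (x - nu) ^ 2 + (a + b - x - nu) ^ 2
  else (x - a) ^ 2 + (lambda * (b - a) - (x - a)) ^ 2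
       + Ctilde a b x lambda mu.

(* Main.v *)
Require Import Defs.
From Stdlib Require Import Reals Lra.
From Coquelicot Require Import Coquelicot.
Open Scope R_scope.

(** [alomari] is the difference of the integrals of [f] against the uniform
    probability on [a,b] and against the atomic probability with masses
    [lambda/2], [(1-lambda) mu], [(1-lambda)(1-mu)], [lambda/2] at [a], [x],
    [a+b-x], [b].  The monotone transport map [T] between them is constant on
    four consecutive intervals, separated by [a + lambda (b-a)/2], [nu2] and
    [b - lambda (b-a)/2], and [Cconst / 2] is the integral of [|t - T t|].  If
    [g] is concave and dominates the modulus of continuity, then
    [|f t - f (T t)| <= g |t - T t|], and Jensen's inequality (in the form of a
    supporting line of [g] at the mean transport distance) gives the bound. *)

(** * Functions continuous relative to a segment, extended to the line by projection *)

Definition clamp (a b t : R) : R := Rmax a (Rmin b t).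

Lemma clamp_in (a b t : R) : a <= b -> segment a b (clamp a b t).
Proof.
  intros Hab; unfold segment, clamp, Rmax, Rmin.
  destruct (Rle_dec b t); destruct (Rle_dec a _); lra.
Qed.

Lemma clamp_id (a b t : R) : segment a b t -> clamp a b t = t.
Proof.
  unfold segment, clamp, Rmax, Rmin; intros [Ha Hb].
  destruct (Rle_dec b t); destruct (Rle_dec a _); lra.
Qed.

Lemma clamp_dist (a b s t : R) :
  Rabs (clamp a b s - clamp a b t) <= Rabs (s - t).
Proof.
  unfold clamp, Rmax, Rmin.
  destruct (Rle_dec b t); destruct (Rle_dec b s);
    repeat destruct (Rle_dec a _); unfold Rabs;
    repeat destruct (Rcase_abs _); lra.
Qed.

(** The projection is 1-Lipschitz with values in [segment a b], so it carries neighbourhoods of [t]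
    into relative neighbourhoods of [clamp a b t]. The composite agrees with [f] on the segment and
    gives access to theorems about two-sided continuity. *)
Lemma continuous_comp_clamp (a b : R) (f : R -> R) (t : R) : a <= b ->
  continuous_on (segment a b) f ->
  continuous (fun s => f (clamp a b s)) t.
Proof.
  intros Hab Hf.
  apply (filterlim_comp _ _ _ (clamp a b) f (locally t)
    (within (segment a b) (locally (clamp a b t)))
    (locally (f (clamp a b t)))).
  - intros P [e He].
    exists e; intros s Hs.
    apply He.
    + apply Rle_lt_trans with (Rabs (s - t)).
      * apply clamp_dist.
      * exact Hs.
    + now apply clamp_in.
  - apply Hf; now apply clamp_in.
Qed.

Lemma continuous_on_segment_bounded (a b : R) (f : R -> R) : a <= b ->
  continuous_on (segment a b) f ->
  exists M, forall t, segment a b t -> Rabs (f t) <= M.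
Proof.
  intros Hab Hf.
  destruct (continuity_ab_maj (fun s => Rabs (f (clamp a b s))) a b Hab)
    as [m [Hm _]].
  - intros t _.
    apply continuity_pt_filterlim.
    apply (continuous_comp (fun s => f (clamp a b s)) Rabs).
    + now apply continuous_comp_clamp.
    + apply continuous_Rabs.
  - exists (Rabs (f (clamp a b m))); intros t Ht.
    specialize (Hm t Ht); now rewrite (clamp_id a b t Ht) in Hm.
Qed.

Lemma ex_RInt_continuous_on (a b u v : R) (f : R -> R) :
  a <= u -> u <= v -> v <= b -> continuous_on (segment a b) f ->
  ex_RInt f u v.
Proof.
  intros Hu Huv Hv Hf.
  apply ex_RInt_ext with (fun s => f (clamp a b s)).
  - intros t; rewrite Rmin_left, Rmax_right by lra; intros Ht.
    rewrite clamp_id; [reflexivity | unfold segment; lra].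
  - apply (@ex_RInt_continuous R_CompleteNormedModule); intros t _.
    apply continuous_comp_clamp; [lra | exact Hf].
Qed.

(** * The modulus of continuity and its concave majorant *)

Lemma modulus_lub (a b : R) (f : R -> R) (M h : R) : a <= b -> 0 <= h ->
  (forall t, segment a b t -> Rabs (f t) <= M) ->
  is_lub_Rbar (fun y => exists u v : R,
    segment a b u /\ segment a b v /\ Rabs (u - v) <= h /\
    y = Rabs (f u - f v)) (modulus a b f h) /\ modulus a b f h <= 2 * M.
Proof.
  intros Hab Hh HM; unfold modulus.
  set (S := fun y => exists u v : R, _).
  destruct (Lub_Rbar_correct S) as [Hub Hlub].
  (* Bounds by 0 and [2 * M] exclude both infinite values, so [real] returns the genuine supremum
     and not its default 0. *)
  assert (H0 : Rbar_le 0 (Lub_Rbar S)).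
  { apply Hub; exists a, a; unfold segment.
    rewrite !Rminus_diag, Rabs_R0; lra. }
  assert (H1 : Rbar_le (Lub_Rbar S) (2 * M)).
  { apply Hlub; intros y (u & v & Hu & Hv & _ & ->); simpl.
    generalize (HM u Hu) (HM v Hv) (Rabs_triang (f u) (- f v)).
    rewrite Rabs_Ropp; unfold Rminus; lra. }
  destruct (Lub_Rbar S) as [r | |]; simpl in *; try contradiction.
  split; [split; assumption | exact H1].
Qed.

Lemma abs_diff_le_modulus (a b : R) (f : R -> R) (M u v : R) :
  (forall t, segment a b t -> Rabs (f t) <= M) ->
  segment a b u -> segment a b v ->
  Rabs (f u - f v) <= modulus a b f (Rabs (u - v)).
Proof.
  intros HM Hu Hv.
  assert (Hab : a <= b) by (unfold segment in Hu; lra).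
  destruct (modulus_lub a b f M (Rabs (u - v)) Hab (Rabs_pos _) HM)
    as [[Hub _] _].
  apply (Hub (Rabs (f u - f v))).
  exists u, v; repeat split; try apply Hu; try apply Hv; lra.
Qed.

(** Reduces the theorem to one admissible [g] at a time. The constant [2 * M] is itself admissible,
    which keeps the infimum finite and [real] harmless. *)
Lemma le_concave_majorant (a b : R) (f : R -> R) (M t y : R) : a <= b ->
  (forall s, segment a b s -> Rabs (f s) <= M) ->
  (forall g, concave_on 0 (b - a) g ->
    (forall h, segment 0 (b - a) h -> modulus a b f h <= g h) -> y <= g t) ->
  y <= concave_majorant a b f t.
Proof.
  intros Hab HM Hy; unfold concave_majorant.
  set (S := fun y => exists g : R -> R, _).
  destruct (Glb_Rbar_correct S) as [Hlb Hglb].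
  assert (H0 : Rbar_le y (Glb_Rbar S)).
  { apply Hglb; intros z (g & Hg & Hdom & ->); simpl.
    now apply Hy. }
  assert (H1 : Rbar_le (Glb_Rbar S) (2 * M)).
  { apply Hlb; exists (fun _ => 2 * M); repeat split.
    - intros s r th _ _ _; lra.
    - intros h Hh; apply (modulus_lub a b f M h); trivial; apply Hh. }
  destruct (Glb_Rbar S) as [r | |]; simpl in *; try contradiction.
  exact H0.
Qed.

(** * Supporting lines of concave functions *)

Lemma concave_on_supporting_line (p q : R) (g : R -> R) (t : R) :
  concave_on p q g -> p < t < q ->
  exists c, forall h, segment p q h -> g h <= g t + c * (h - t).
Proof.
  intros Hg Ht.
  assert (Hslope : forall r s, segment p q r -> segment p q s -> r < t < s ->
    (g s - g t) / (s - t) <= (g t - g r) / (t - r)).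
  { intros r s Hr Hs Hrs.
    assert (H := Hg r s ((s - t) / (s - r)) Hr Hs).
    replace ((s - t) / (s - r) * r + (1 - (s - t) / (s - r)) * s) with t in H
      by (field; lra).
    replace (1 - (s - t) / (s - r)) with ((t - r) / (s - r)) in H
      by (field; lra).
    assert (H1 : 0 <= (s - t) / (s - r) <= 1).
    { split; [apply Rdiv_le_0_compat | apply Rle_div_l]; lra. }
    specialize (H H1).
    apply Rmult_le_compat_l with (r := s - r) in H; [| lra].
    replace ((s - r) * ((s - t) / (s - r) * g r + (t - r) / (s - r) * g s))
      with ((s - t) * g r + (t - r) * g s) in H by (field; lra).
    apply Rle_div_l; [lra |].
    replace ((g t - g r) / (t - r) * (s - t))
      with ((g t - g r) * (s - t) / (t - r)) by (field; lra).
    apply Rle_div_r; [lra |]; nra. }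
  (* The slope [c] is the right derivative of [g] at [t], as the supremum of chord slopes to the
     right. The chord from [p] bounds them and the chord to [q] is one of them; this is where [t]
     has to be interior. *)
  destruct (completeness (fun y => exists s, segment p q s /\ t < s /\
    y = (g s - g t) / (s - t))) as [c [Hub Hlub]].
  - exists ((g t - g p) / (t - p)).
    intros y (s & Hs & Hts & ->).
    apply Hslope; unfold segment in *; lra.
  - exists ((g q - g t) / (q - t)), q; unfold segment; repeat split; lra.
  - exists c; intros h Hh.
    destruct (Rtotal_order h t) as [Hlt | [-> | Hgt]].
    + assert (Hc : c <= (g t - g h) / (t - h)).
      { apply Hlub; intros y (s & Hs & Hts & ->).
        apply Hslope; trivial; lra. }
      apply Rle_div_r in Hc; lra.
    + lra.
    + assert (Hc : (g h - g t) / (h - t) <= c).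
      { apply Hub; exists h; repeat split; trivial; apply Hh. }
      apply Rle_div_l in Hc; lra.
Qed.

(** * Integrals of the distance to a point *)

Definition dist_integral (u v z : R) : R :=
  ((v - z) * Rabs (v - z) - (u - z) * Rabs (u - z)) / 2.

(** A single primitive of the absolute value valid on the whole line, so [dist_integral] needs no
    cases on the position of [z] relative to [u] and [v]. *)
Lemma is_derive_mul_abs (s : R) :
  is_derive (fun t => t * Rabs t / 2) s (Rabs s).
Proof.
  destruct (Req_dec s 0) as [-> | Hs].
  - rewrite Rabs_R0; apply is_derive_Reals; intros e He.
    exists (mkposreal e He); intros h Hh He'; simpl in He'.
    rewrite Rplus_0_l, Rabs_R0.
    replace ((h * Rabs h / 2 - 0 * 0 / 2) / h - 0) with (Rabs h / 2)
      by (field; exact Hh).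
    generalize (Rabs_pos h); intros H.
    rewrite Rabs_pos_eq; lra.
  - auto_derive; [exact Hs |].
    destruct (Rlt_or_le s 0) as [Hneg | Hpos].
    + rewrite sign_eq_m1, Rabs_left by lra; field.
    + rewrite sign_eq_1, Rabs_pos_eq by lra; field.
Qed.

Lemma is_RInt_dist (u v z : R) :
  is_RInt (fun t => Rabs (t - z)) u v (dist_integral u v z).
Proof.
  replace (dist_integral u v z)
    with (minus ((v - z) * Rabs (v - z) / 2) ((u - z) * Rabs (u - z) / 2))
    by (unfold dist_integral, minus, plus, opp; simpl; field).
  apply (is_RInt_derive (fun t => (t - z) * Rabs (t - z) / 2)).
  - intros t _.
    evar_last.
    + apply (is_derive_comp (fun s => s * Rabs s / 2) (fun t => t - z)).
      * apply is_derive_mul_abs.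
      * auto_derive; trivial.
    + unfold scal; simpl; unfold mult; simpl; ring.
  - intros t _.
    apply (continuous_comp (fun t => t - z) Rabs).
    + apply (continuous_minus (fun t => t) (fun _ => z)).
      * apply continuous_id.
      * apply continuous_const.
    + apply continuous_Rabs.
Qed.

(** The lower bound is attained when [z] is the midpoint of [u] and [v], the upper one when [z] is
    an end of [a,b] and [u,v] lies at the other end. They serve to place the mean transport distance
    strictly between 0 and [b - a]. *)
Lemma dist_integral_bounds (a b u v z : R) :
  a <= u -> u <= v -> v <= b -> a <= z <= b ->
  (v - u) ^ 2 / 4 <= dist_integral u v z
    <= (b - a) * (v - u) - (v - u) ^ 2 / 2.
Proof.
  intros Hu Huv Hv Hz; unfold dist_integral.
  split; unfold Rabs; destruct (Rcase_abs (v - z)); destruct (Rcase_abs (u - z));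
    nra || (generalize (pow2_ge_0 (v - z - (z - u))); lra).
Qed.

(** The cost of moving the mass of [u,v] to the atom [z], with [y] standing for [f z]: a bound
    affine in the distance integrates exactly to [dist_integral]. *)
Lemma RInt_sub_const_bound (f : R -> R) (u v z y al c : R) :
  u <= v -> ex_RInt f u v ->
  (forall t, u < t < v -> Rabs (f t - y) <= al + c * Rabs (t - z)) ->
  Rabs (RInt f u v - (v - u) * y) <= al * (v - u) + c * dist_integral u v z.
Proof.
  intros Huv Hf Hb.
  assert (H1 : is_RInt (fun t => f t - y) u v (RInt f u v - (v - u) * y)).
  { apply (is_RInt_minus f (fun _ => y)).
    - now apply (@RInt_correct R_CompleteNormedModule).
    - apply (is_RInt_const u v y). }
  assert (H2 : is_RInt (fun t => al + c * Rabs (t - z)) u v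
    (al * (v - u) + c * dist_integral u v z)).
  { rewrite (Rmult_comm al).
    apply (is_RInt_plus (fun _ => al) (fun t => c * Rabs (t - z))).
    - apply (is_RInt_const u v al).
    - apply (is_RInt_scal (fun t => Rabs (t - z))), is_RInt_dist. }
  apply Rabs_le; split.
  - apply (is_RInt_le (fun t => - (al + c * Rabs (t - z))) (fun t => f t - y) u v);
      trivial.
    + now apply (is_RInt_opp (fun t => al + c * Rabs (t - z))).
    + intros t Ht; generalize (Hb t Ht) (Rle_abs (- (f t - y))).
      rewrite Rabs_Ropp; lra.
  - apply (is_RInt_le (fun t => f t - y) (fun t => al + c * Rabs (t - z)) u v);
      trivial.
    intros t Ht; generalize (Hb t Ht) (Rle_abs (f t - y)); lra.
Qed.

(** The branches of [Cconst] and [Ctilde] record the signs of [x - p], [x - nu] and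
    [a + b - x - nu], which turn each product [s * Rabs s] in [dist_integral] into a signed
    square. *)
Lemma Cconst_dist_integral (a b x lambda mu : R) : a < b ->
  0 <= lambda <= 1 -> 0 <= mu <= 1 -> a <= x <= (a + b) / 2 ->
  let p := a + lambda * ((b - a) / 2) in
  let nu := nu2 a b lambda mu in
  Cconst a b x lambda mu = 2 *
    (dist_integral a p a + dist_integral p nu x
     + dist_integral nu (a + b - p) (a + b - x)
     + dist_integral (a + b - p) b b).
Proof.
  intros Hab Hl Hm Hx p nu.
  assert (Hp : a <= p <= (a + b) / 2) by (unfold p; nra).
  assert (Hnu : p <= nu <= a + b - p).
  { unfold nu, nu2, p.
    assert (0 <= (b - a) * (mu * (1 - lambda))) by
      (repeat apply Rmult_le_pos; lra).
    assert (0 <= (b - a) * ((1 - mu) * (1 - lambda))) by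
      (repeat apply Rmult_le_pos; lra).
    lra. }
  (* The midpoint separates [x] from [a + b - x]. Hence [mu <= 1 / 2] fixes the position of [nu]
     relative to [a + b - x], and [1 / 2 < mu] fixes it relative to [x]. *)
  assert (Hlo : mu <= 1 / 2 -> nu <= (a + b) / 2).
  { intros H.
    assert (0 <= (b - a) * ((1 / 2 - mu) * (1 - lambda))) by
      (repeat apply Rmult_le_pos; lra).
    unfold nu, nu2; lra. }
  assert (Hhi : 1 / 2 < mu -> (a + b) / 2 <= nu).
  { intros H.
    assert (0 <= (b - a) * ((mu - 1 / 2) * (1 - lambda))) by
      (repeat apply Rmult_le_pos; lra).
    unfold nu, nu2; lra. }
  assert (Hlam : lambda * (b - a) = 2 * (p - a)) by (unfold p; field).
  unfold Cconst, Ctilde; fold p nu.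
  replace (2 * lambda * (x - a) * (b - a)) with (2 * (2 * (p - a)) * (x - a))
    by (rewrite <- Hlam; ring).
  rewrite Hlam; clearbody p nu.
  unfold dist_integral.
  rewrite !Rminus_diag, Rabs_R0, (Rabs_pos_eq (p - a)) by lra.
  rewrite (Rabs_left1 (a + b - p - b)) by lra.
  destruct (Rle_dec x p).
  - rewrite (Rabs_pos_eq (nu - x)), (Rabs_pos_eq (p - x)),
      (Rabs_left1 (a + b - p - (a + b - x))), (Rabs_left1 (nu - (a + b - x)))
      by lra.
    field.
  - rewrite (Rabs_left1 (p - x)), (Rabs_pos_eq (a + b - p - (a + b - x))) by lra.
    destruct (Rle_dec mu (1 / 2)).
    + specialize (Hlo r); rewrite (Rabs_left1 (nu - (a + b - x))) by lra.
      destruct (Rle_dec x nu).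
      * rewrite (Rabs_pos_eq (nu - x)) by lra; field.
      * rewrite (Rabs_left1 (nu - x)) by lra; field.
    + assert (H := Hhi ltac:(lra)); rewrite (Rabs_pos_eq (nu - x)) by lra.
      destruct (Rle_dec x (a + b - nu)).
      * rewrite (Rabs_left1 (nu - (a + b - x))) by lra; field.
      * rewrite (Rabs_pos_eq (nu - (a + b - x))) by lra; field.
Qed.

(** * The transport estimate on four intervals *)

Theorem mainTheorem2 :
  forall (a b : R), a < b ->
  forall (f : R -> R), continuous_on (segment a b) f ->
  forall (lambda mu : R), 0 <= lambda <= 1 -> 0 <= mu <= 1 ->
  forall (x : R), a <= x <= (a + b) / 2 ->
    Rabs (alomari a b f lambda mu x)
      <= concave_majorant a b f (Cconst a b x lambda mu / (2 * (b - a))).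
Proof.
  intros a b Hab f Hf lambda mu Hl Hm x Hx.
  destruct (continuous_on_segment_bounded a b f) as [M HM]; [lra | trivial |].
  apply le_concave_majorant with M; [lra | trivial |].
  intros g Hg Hdom.
  rewrite Cconst_dist_integral by trivial.
  set (p := a + lambda * ((b - a) / 2)); set (nu := nu2 a b lambda mu).
  set (q := a + b - p).
  assert (Hp : a <= p <= (a + b) / 2) by (unfold p; nra).
  (* The breakpoints are chosen so that each interval has length [b - a] times the mass of its
     atom. *)
  assert (Hmass1 : nu - p = (b - a) * ((1 - lambda) * mu))
    by (unfold nu, nu2, p; field).
  assert (Hmass2 : q - nu = (b - a) * ((1 - lambda) * (1 - mu)))
    by (unfold q, nu, nu2, p; field).
  assert (Hpnu : p <= nu).
  { assert (0 <= (b - a) * ((1 - lambda) * mu)) by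
      (repeat apply Rmult_le_pos; lra). lra. }
  assert (Hnuq : nu <= q).
  { assert (0 <= (b - a) * ((1 - lambda) * (1 - mu))) by
      (repeat apply Rmult_le_pos; lra). lra. }
  assert (Hqb : b - q = p - a) by (unfold q; ring).
  assert (Hmass0 : p - a = (b - a) * (lambda / 2)) by (unfold p; field).
  set (total := _ + _ + _ + _).
  replace (2 * total / (2 * (b - a))) with (total / (b - a)) by (field; lra).
  (* A supporting line requires the mean distance to be interior. Summing the bounds on the four
     pieces puts [total] between a quarter of the sum of squared lengths and [(b - a) ^ 2] minus
     half that sum; by Cauchy-Schwarz the sum is at least [(b - a) ^ 2 / 4]. *)
  assert (Hint : 0 < total / (b - a) < b - a - 0).
  { destruct (dist_integral_bounds a b a p a); try lra.
    destruct (dist_integral_bounds a b p nu x); try lra.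
    destruct (dist_integral_bounds a b nu q (a + b - x)); try lra.
    destruct (dist_integral_bounds a b q b b); try lra.
    assert (Hsq : (b - a) ^ 2 <=
      4 * ((p - a) ^ 2 + (nu - p) ^ 2 + (q - nu) ^ 2 + (b - q) ^ 2)).
    { replace (b - a) with ((p - a) + (nu - p) + (q - nu) + (b - q)) by ring.
      generalize (p - a) (nu - p) (q - nu) (b - q); intros r1 r2 r3 r4.
      generalize (pow2_ge_0 (r1 - r2)) (pow2_ge_0 (r1 - r3))
        (pow2_ge_0 (r1 - r4)) (pow2_ge_0 (r2 - r3)) (pow2_ge_0 (r2 - r4))
        (pow2_ge_0 (r3 - r4)); lra. }
    assert (0 < (b - a) ^ 2) by (apply pow_lt; lra).
    assert ((b - a) * (p - a) + (b - a) * (nu - p) + (b - a) * (q - nu)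
      + (b - a) * (b - q) = (b - a) ^ 2) by ring.
    split.
    - apply Rdiv_lt_0_compat; [unfold total; lra | lra].
    - apply Rlt_div_l; [lra |]; unfold total; lra. }
  destruct (concave_on_supporting_line 0 (b - a) g (total / (b - a)))
    as [c Hc]; [trivial | lra |].
  (* Intercept of the supporting line: [al + c * h] dominates [g h] on [0,b-a]. *)
  set (al := g (total / (b - a)) - c * (total / (b - a))).
  assert (Hbound : forall u v z, a <= u -> u <= v -> v <= b -> segment a b z ->
    Rabs (RInt f u v - (v - u) * f z)
      <= al * (v - u) + c * dist_integral u v z).
  { intros u v z Hu Huv Hv Hz.
    apply RInt_sub_const_bound; trivial.
    - now apply ex_RInt_continuous_on with a b.
    - intros t Ht.
      assert (Hs : segment a b t) by (unfold segment; lra).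
      assert (Hd : segment 0 (b - a) (Rabs (t - z))).
      { unfold segment in *; split; [apply Rabs_pos | apply Rabs_le; lra]. }
      generalize (abs_diff_le_modulus a b f M t z HM Hs Hz) (Hdom _ Hd) (Hc _ Hd).
      unfold al; lra. }
  assert (B1 := Hbound a p a ltac:(lra) ltac:(lra) ltac:(lra)
    ltac:(unfold segment; lra)).
  assert (B2 := Hbound p nu x ltac:(lra) ltac:(lra) ltac:(lra)
    ltac:(unfold segment; lra)).
  assert (B3 := Hbound nu q (a + b - x) ltac:(lra) ltac:(lra) ltac:(lra)
    ltac:(unfold segment; lra)).
  assert (B4 := Hbound q b b ltac:(lra) ltac:(lra) ltac:(lra)
    ltac:(unfold segment; lra)).
  assert (Hsplit : RInt f a b = RInt f a p + RInt f p nu + RInt f nu q + RInt f q b).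
  { rewrite <- (RInt_Chasles f a q b), <- (RInt_Chasles f a nu q),
      <- (RInt_Chasles f a p nu); [reflexivity | ..];
      apply ex_RInt_continuous_on with a b; trivial; lra. }
  (* By the mass identities, each atomic term of [alomari] pairs with the integral over its own
     interval. *)
  assert (HE : alomari a b f lambda mu x = / (b - a) *
    ((RInt f a p - (p - a) * f a) + (RInt f p nu - (nu - p) * f x)
     + (RInt f nu q - (q - nu) * f (a + b - x)) + (RInt f q b - (b - q) * f b))).
  { unfold alomari; rewrite Hsplit, Hqb, Hmass0, Hmass1, Hmass2; field; lra. }
  rewrite HE, Rabs_mult, Rabs_pos_eq
    by (apply Rlt_le, Rinv_0_lt_compat; lra).
  rewrite Rmult_comm; apply Rle_div_l; [lra |].
  (* The line touches [g] at the mean distance, so the four bounds add up to exactly the value of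
     [g] there, times [b - a]. *)
  assert (Htot : g (total / (b - a)) * (b - a) = al * (b - a) + c * total)
    by (unfold al; field; lra).
  rewrite Htot; unfold total.
  apply Rabs_le_between in B1, B2, B3, B4.
  apply Rabs_le; split; lra.
Qed.
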